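(* For every $n\ge 1$, $$\sum_{\pi\in\mathfrak{S}_n,\ \mathcal{T}(\pi)=\mathrm{id}} x^{1+\mathrm{des}(\pi)} \;=\; \sum_{0\le k<n}\frac1n\binom{n}{k}\binom{n}{k+1}x^{n-k} \;=\; \sum_{\pi\in\mathfrak{S}_n,\ \mathcal{S}(\pi)=\mathrm{id}} x^{1+\mathrm{des}(\pi)}.$$
   Context: $\mathfrak{S}_n$ is the set of permutations of $\{1,\ldots,n\}$, written as words; $\mathrm{id}=12\cdots n$; $\mathrm{des}(\pi)$ is the number of indices $i$ with $\pi_i>\pi_{i+1}$. The operators $\mathcal{S}$ (stack sort) and $\mathcal{T}$ (revstack sort) are defined recursively on finite words of distinct positive integers: both fix the empty word and words of length 1, and $\mathcal{S}(LmR)=\mathcal{S}(L)\,\mathcal{S}(R)\,m$, $\mathcal{T}(LmR)=\mathcal{T}(R)\,\mathcal{T}(L)\,m$, where $m$ is the largest entry of $LmR$. *)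

(* Defs.v *)
From mathcomp Require Import all_boot.

Set Implicit Arguments.
Unset Strict Implicit.
Unset Printing Implicit Defensive.

Definition maxentry (w : seq nat) : nat := \max_(x <- w) x.

(* The decomposition w = L m R at the (first occurrence of the) largest
   entry m of w is (before_max w, maxentry w, after_max w). *)
Definition before_max (w : seq nat) : seq nat := take (index (maxentry w) w) w.
Definition after_max (w : seq nat) : seq nat :=
  drop (index (maxentry w) w).+1 w.

(* The argument d bounds the recursion depth; d = size w always suffices, and
   the recursive equations without d are stack_sort_cat and
   revstack_sort_cat below. *)
Fixpoint stack_sort_rec (d : nat) (w : seq nat) : seq nat :=
  if d is d'.+1 then
    if w is [::] then [::] else
      stack_sort_rec d' (before_max w) ++ stack_sort_rec d' (after_max w)
        ++ [:: maxentry w]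
  else [::].

Fixpoint revstack_sort_rec (d : nat) (w : seq nat) : seq nat :=
  if d is d'.+1 then
    if w is [::] then [::] else
      revstack_sort_rec d' (after_max w) ++ revstack_sort_rec d' (before_max w)
        ++ [:: maxentry w]
  else [::].

Definition stack_sort (w : seq nat) : seq nat := stack_sort_rec (size w) w.
Definition revstack_sort (w : seq nat) : seq nat :=
  revstack_sort_rec (size w) w.

Definition des (w : seq nat) : nat :=
  count (fun i => nth 0 w i.+1 < nth 0 w i) (iota 0 (size w).-1).

Definition idword (n : nat) : seq nat := iota 1 n.

Definition permwords (n : nat) : seq (seq nat) := permutations (idword n).

Lemma maxentry_in x w : maxentry (x :: w) \in x :: w.
Proof.
rewrite /maxentry; elim: w x => [|y w IHw] x.
  by rewrite big_seq1 mem_seq1.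
rewrite big_cons; case: leqP => _; first by rewrite inE IHw orbT.
by rewrite mem_head.
Qed.

Lemma size_before_max x w : size (before_max (x :: w)) <= size w.
Proof. by rewrite -ltnS size_take_min gtn_min index_mem maxentry_in. Qed.

Lemma size_after_max x w : size (after_max (x :: w)) <= size w.
Proof. by rewrite size_drop /= subSS leq_subr. Qed.

Lemma stack_sort_recE d w : size w <= d -> stack_sort_rec d w = stack_sort w.
Proof.
rewrite /stack_sort; have [e le_e] := ubnP (size w).
elim: e d w le_e => // e IHe [|d] [|x w] // le_e le_d.
have IH t : size t <= size w -> stack_sort_rec d t = stack_sort_rec (size w) t.
  move=> le_t; have lt_t := leq_ltn_trans le_t le_e.
  by rewrite (IHe d) ?(IHe (size w)) // (leq_trans le_t).
by rewrite /= !IH ?size_before_max ?size_after_max.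
Qed.

Lemma revstack_sort_recE d w :
  size w <= d -> revstack_sort_rec d w = revstack_sort w.
Proof.
rewrite /revstack_sort; have [e le_e] := ubnP (size w).
elim: e d w le_e => // e IHe [|d] [|x w] // le_e le_d.
have IH t : size t <= size w -> revstack_sort_rec d t = revstack_sort_rec (size w) t.
  move=> le_t; have lt_t := leq_ltn_trans le_t le_e.
  by rewrite (IHe d) ?(IHe (size w)) // (leq_trans le_t).
by rewrite /= !IH ?size_before_max ?size_after_max.
Qed.

Lemma maxentry_cat m L R :
  all (fun x => x < m) L -> all (fun x => x < m) R ->
  maxentry (L ++ m :: R) = m.
Proof.
move=> ltLm ltRm; apply/eqP; rewrite eqn_leq /maxentry; apply/andP; split.
  apply/bigmax_leqP_seq => x; rewrite mem_cat inE.
  case/or3P=> [xL|/eqP->|xR] _ //; apply: ltnW.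
    exact: (allP ltLm).
  exact: (allP ltRm).
by rewrite big_cat big_cons /= maxnCA leq_maxl.
Qed.

Lemma index_max_cat m L R :
  all (fun x => x < m) L -> index m (L ++ m :: R) = size L.
Proof.
move=> ltLm; rewrite index_cat /= eqxx addn0; case: ifP => // mL.
by have := allP ltLm _ mL; rewrite ltnn.
Qed.

Lemma before_max_cat m L R :
  all (fun x => x < m) L -> all (fun x => x < m) R ->
  before_max (L ++ m :: R) = L.
Proof.
by move=> ltLm ltRm; rewrite /before_max maxentry_cat // index_max_cat //
  take_size_cat.
Qed.

Lemma after_max_cat m L R :
  all (fun x => x < m) L -> all (fun x => x < m) R ->
  after_max (L ++ m :: R) = R.
Proof.
by move=> ltLm ltRm; rewrite /after_max maxentry_cat // index_max_cat //
  -cat_rcons drop_size_cat ?size_rcons.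
Qed.

Lemma stack_sort_cat m L R :
  all (fun x => x < m) L -> all (fun x => x < m) R ->
  stack_sort (L ++ m :: R) = stack_sort L ++ stack_sort R ++ [:: m].
Proof.
move=> ltLm ltRm; rewrite {1}/stack_sort size_cat addnS /=.
case def_w: (L ++ m :: R) => [|x w]; first by case: (L) def_w.
rewrite -def_w before_max_cat // after_max_cat // maxentry_cat //.
by rewrite !stack_sort_recE ?leq_addl ?leq_addr.
Qed.

Lemma revstack_sort_cat m L R :
  all (fun x => x < m) L -> all (fun x => x < m) R ->
  revstack_sort (L ++ m :: R) = revstack_sort R ++ revstack_sort L ++ [:: m].
Proof.
move=> ltLm ltRm; rewrite {1}/revstack_sort size_cat addnS /=.
case def_w: (L ++ m :: R) => [|x w]; first by case: (L) def_w.
rewrite -def_w before_max_cat // after_max_cat // maxentry_cat //.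
by rewrite !revstack_sort_recE ?leq_addl ?leq_addr.
Qed.

Lemma stack_sort0 : stack_sort [::] = [::].
Proof. by []. Qed.

Lemma stack_sort1 m : stack_sort [:: m] = [:: m].
Proof. exact: (@stack_sort_cat m [::] [::] isT isT). Qed.

Lemma revstack_sort0 : revstack_sort [::] = [::].
Proof. by []. Qed.

Lemma revstack_sort1 m : revstack_sort [:: m] = [:: m].
Proof. exact: (@revstack_sort_cat m [::] [::] isT isT). Qed.

(* Main.v *)
Require Import Defs.
From mathcomp Require Import all_boot all_order all_algebra.
From mathcomp Require Import ring zify.

(** Split a word at its largest entry, pi = L m R.  Since S(pi) = S(L) S(R) m
    and T(pi) = T(R) T(L) m, the word pi is sent to the identity exactly when
    both factors are sent to increasing words and the one that is output first,
    of length i say, is made of the i smallest entries: that factor is L for S and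
    R for T.  In both cases the sortable words of length n+1 are the pairs of
    sortable words of lengths i and n-i.  Weighting a nonempty word by
    x^(1+des) and the empty word by 1, the weight of L m R is the product of the
    weights of L and R, times x if L is empty ([weight_max_cat]).  So for both
    operators the generating polynomials N_n satisfy
      N_(n+1) = sum_(i <= n) N_i N_(n-i) + (x - 1) N_n,   N_0 = 1;
    that L is the factor of length i in one case and the factor of length n-i
    in the other is absorbed by the symmetry of the convolution
    ([narayana_rec]).

    It remains to solve this recursion without Lagrange inversion.  It says
    that P = sum_n N_n z^n satisfies P = 1 + z P (P + x - 1), hence
      P^(k+1) = P^k + z (P^(k+2) + (x - 1) P^(k+1)),
    and this relation, together with P^0 = 1 and P^k(0) = 1, determines all the
    coefficients [z^n] P^k by induction on n, then k.  The closed form that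
    Lagrange inversion predicts for them, [narayana_pow], is checked to satisfy
    the relation ([narayana_pow_rec], a binomial identity), and the same double
    induction shows that multiplying by P raises k by one
    ([narayana_pow_conv]).  For k = 0 the relation expresses [z^(n+1)] P through
    [z^n] P^2 and [z^n] P, and writing P^2 as P P turns it into the recursion. *)

Set Implicit Arguments.
Unset Strict Implicit.
Unset Printing Implicit Defensive.

Import GRing.Theory Num.Theory.
Local Open Scope ring_scope.

(** * Coefficients of the powers of the Narayana series *)

(** The coefficient of z^(n+1) x^(i+1) in P^k.  Lagrange inversion applied to
    P - 1 = z (1 + (P - 1)) (x + (P - 1)) gives k/(n+1) C(n+k, i) C(n+1, i+1);
    absorbing n+1 into the second binomial leaves the form below, which is a
    polynomial in k and n for each i. *)
Definition narayana_coef (n k i : nat) : rat :=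
  k%:R / i.+1%:R * 'C(n + k, i)%:R * 'C(n, i)%:R.

(** The coefficient of z^n in P^k, as a polynomial in x. *)
Definition narayana_pow (n k : nat) : {poly rat} :=
  if n is m.+1 then 'X * \poly_(i < n) narayana_coef m k i else 1.

Arguments narayana_pow : simpl never.

Definition narayana (n : nat) : {poly rat} := narayana_pow n 1.

Lemma narayana_coef_rec0 n k :
  narayana_coef n.+1 k.+1 0 =
  narayana_coef n.+1 k 0 + narayana_coef n k.+2 0 - narayana_coef n k.+1 0.
Proof. by rewrite /narayana_coef !bin0 -![in RHS]natr1 -natr1; field. Qed.

(** After Pascal's rule every binomial is a rational multiple of C(n+k+1, i) or
    C(n, i), and the identity becomes one between rational functions. *)
Lemma narayana_coef_rec n k i :
  narayana_coef n.+1 k.+1 i.+1 =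
  narayana_coef n.+1 k i.+1 + narayana_coef n k.+2 i.+1
  + narayana_coef n k.+1 i - narayana_coef n k.+1 i.+1.
Proof.
have mul_bin m : i.+1%:R * 'C(m, i.+1)%:R = (m%:R - i%:R) * 'C(m, i)%:R :> rat.
  have [le_im | lt_mi] := leqP i m; last by rewrite !bin_small ?mulr0 ?leqW.
  by rewrite -natrB // -!natrM mul_bin_left.
have pascal m : 'C(m.+1, i.+1)%:R = 'C(m, i.+1)%:R + 'C(m, i)%:R :> rat.
  by rewrite binS natrD.
rewrite /narayana_coef !addnS addSn (pascal (n + k).+1) (pascal n).
have := mul_bin (n + k).+1; have := mul_bin n; rewrite -(natr1 (n + k)) natrD.
move: ('C((n + k).+1, i)%:R : rat) ('C((n + k).+1, i.+1)%:R : rat) => A B.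
move: ('C(n, i)%:R : rat) ('C(n, i.+1)%:R : rat) => p q Eq EB.
have i1_neq0 : i.+1%:R != 0 :> rat by rewrite pnatr_eq0.
have i2_neq0 : i.+2%:R != 0 :> rat by rewrite pnatr_eq0.
have -> : B = (n%:R + k%:R + 1 - i%:R) * A / i.+1%:R by rewrite -EB mulrC mulKf.
have -> : q = (n%:R - i%:R) * p / i.+1%:R by rewrite -Eq mulrC mulKf.
move: i1_neq0 i2_neq0; rewrite -!natr1 => ? ?; field.
by apply/andP; split.
Qed.

Lemma coef_narayana_pow n k j :
  (narayana_pow n.+1 k)`_j = if j is i.+1 then narayana_coef n k i else 0.
Proof.
rewrite coefXM; case: j => //= i; rewrite coef_poly.
by case: ltnP => // lt_ni; rewrite /narayana_coef (bin_small lt_ni) mulr0.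
Qed.

Lemma narayana_pow0 n : narayana_pow n 0 = (n == 0%N)%:R.
Proof.
case: n => // n; apply/polyP => j; rewrite coef_narayana_pow coef0.
by case: j => // i; rewrite /narayana_coef !mul0r.
Qed.

(** This is P^(k+1) = P^k + z (P^(k+2) + (x - 1) P^(k+1)), read at z^(n+1). *)
Lemma narayana_pow_rec n k :
  narayana_pow n.+1 k.+1 =
  narayana_pow n.+1 k + narayana_pow n k.+2 + ('X - 1) * narayana_pow n k.+1.
Proof.
apply/polyP => j; rewrite mulrBl mul1r !(coefD, coefN).
rewrite !coef_narayana_pow (coefXM (narayana_pow n k.+1)); case: n => [|n].
  rewrite !coef1; case: j => [|[|i]] /=; first by ring.
    by rewrite /narayana_coef !bin0 -natr1; field.
  by rewrite /narayana_coef bin0n !mulr0 add0r subrr.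
rewrite !coef_narayana_pow; case: j => [|[|i]] /=; first by ring.
  by rewrite narayana_coef_rec0; ring.
by rewrite narayana_coef_rec; ring.
Qed.

(** This is P^k P = P^(k+1).  Both sides satisfy [narayana_pow_rec], which
    reduces (n+1, k+1) to (n+1, k) and to the exponents k+1 and k+2 at n, hence
    the induction on n with k universally quantified, then on k. *)
Lemma narayana_pow_conv n k :
  \sum_(i < n.+1) narayana_pow i k * narayana (n - i) = narayana_pow n k.+1.
Proof.
elim: n k => [|n IHn] k; first by rewrite big_ord1 mulr1.
elim: k => [|k IHk].
  rewrite big_ord_recl narayana_pow0 mul1r subn0 big1 ?addr0 // => i _.
  by rewrite narayana_pow0 mul0r.
rewrite narayana_pow_rec -IHk big_ord_recl [in RHS]big_ord_recl -!addrA.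
congr (_ + _); rewrite -!IHn mulr_sumr -!big_split; apply: eq_bigr => i _.
by rewrite !lift0 narayana_pow_rec subSS /=; ring.
Qed.

(** The factor x marks the empty left part of a word split at its maximum; the
    boolean tells whether that part is the one of length i (for S) or the one
    of length n-i (for T). *)
Lemma narayana_rec (b : bool) n :
  narayana n.+1 =
  \sum_(i < n.+1) (if (if b then i : nat else n - i)%N == 0%N then 'X else 1)
                  * (narayana i * narayana (n - i)).
Proof.
have left_rec : narayana n.+1 =
    \sum_(i < n.+1) (if i == 0%N :> nat then 'X else 1)
                    * (narayana i * narayana (n - i)).
  rewrite /narayana narayana_pow_rec narayana_pow0 add0r -narayana_pow_conv.
  rewrite big_ord_recl [in RHS]big_ord_recl /= subn0 /narayana.
  under [in RHS]eq_bigr do rewrite mul1r.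
  by rewrite /narayana_pow /=; ring.
case: b; rewrite left_rec // (reindex_inj rev_ord_inj).
apply: eq_bigr => i _; have le_in : (i <= n)%N by rewrite -ltnS.
by rewrite /= subSS subKn // [narayana i * _]mulrC.
Qed.

(** The exponent n-k decreases with k, so the sum is read backwards, and the
    symmetry of binomial coefficients turns C(n, k) C(n, k+1) into
    C(n, j+1) C(n, j) where n-k = j+1. *)
Lemma narayanaE n : (0 < n)%N ->
  narayana n = \sum_(0 <= k < n)
    (n%:R^-1 * 'C(n, k)%:R * 'C(n, k.+1)%:R) *: 'X^(n - k)%N.
Proof.
case: n => // n _; rewrite big_nat_rev /= big_mkord.
rewrite /narayana /narayana_pow poly_def mulr_sumr; apply: eq_bigr => i _.
have le_in : (i <= n)%N by rewrite -ltnS.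
rewrite add0n subKn // -scalerAr -exprS; congr (_ *: _).
rewrite bin_sub // subSS -subSn // bin_sub ?leqW //.
have i1_neq0 : i.+1%:R != 0 :> rat by rewrite pnatr_eq0.
have n1_neq0 : n.+1%:R != 0 :> rat by rewrite pnatr_eq0.
have := congr1 (fun m => m%:R : rat) (mul_bin_diag n.+1 i).
rewrite /narayana_coef addn1 !natrM /= => E.
have -> : 'C(n, i)%:R = i.+1%:R * 'C(n.+1, i.+1)%:R / n.+1%:R :> rat.
  by rewrite -E mulrC mulKf.
by move: i1_neq0 n1_neq0; rewrite -!natr1 => ? ?; field; apply/andP; split.
Qed.

(** * Descents of a word split at its maximum *)

Lemma des_cons2 x y w : des (x :: y :: w) = ((y < x) + des (y :: w))%N.
Proof. by rewrite /des /= -[1%N]addn0 iotaDl count_map. Qed.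

(** An entry of L never exceeds m, so no descent ends at m, and the one that
    starts at m exists as soon as R is nonempty. *)
Lemma des_max_cat m L R : all (ltn^~ m) L -> all (ltn^~ m) R ->
  des (L ++ m :: R) = (des L + (R != [::]) + des R)%N.
Proof.
move=> + ltRm; elim: L => [|x L IHL] /=.
  by case: R ltRm => // y R /andP[/= lt_ym _]; rewrite des_cons2 lt_ym.
case/andP=> /= lt_xm /IHL{}IHL; case: L IHL => [|y L] /= IHL; last first.
  by rewrite !des_cons2 IHL !addnA.
by rewrite des_cons2 IHL ltnNge ltnW.
Qed.

(** The empty word has weight 1 rather than x, so that weights multiply. *)
Definition weight (w : seq nat) : {poly rat} :=
  if w is [::] then 1 else 'X^(1 + des w).

(** The descent from m to a nonempty R accounts for the second 1 in
    (1 + des L) + (1 + des R); when L is empty, weight L = 1 does not provide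
    the first 1, whence the factor x. *)
Lemma weight_max_cat m L R : all (ltn^~ m) L -> all (ltn^~ m) R ->
  weight (L ++ m :: R) =
  (if size L == 0%N then 'X else 1) * (weight L * weight R).
Proof.
move=> ltLm ltRm.
have -> : weight (L ++ m :: R) = 'X^(1 + des (L ++ m :: R)) by case: (L).
rewrite des_max_cat //; case: L {ltLm} => [|x L]; case: R {ltRm} => [|y R] /=.
- by rewrite !mulr1.
- by rewrite mul1r -exprS.
- by rewrite mulr1 mul1r !addn0.
- by rewrite mul1r -exprD; congr ('X^ _); lia.
Qed.

(** * Words sorted by a recursion on the maximum *)

(** U is to be the factor that is output first, whichever side it is on,
    so that S and T obey the same equation. *)
Definition max_node (b : bool) (m : nat) (U V : seq nat) : seq nat :=
  if b then U ++ m :: V else V ++ m :: U.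

Definition max_sorter (b : bool) (f : seq nat -> seq nat) : Prop :=
  f [::] = [::] /\
  forall m U V, all (ltn^~ m) U -> all (ltn^~ m) V ->
    f (max_node b m U V) = f U ++ f V ++ [:: m].

Lemma stack_sort_max_sorter : max_sorter true stack_sort.
Proof. by split=> // m U V; apply: stack_sort_cat. Qed.

Lemma revstack_sort_max_sorter : max_sorter false revstack_sort.
Proof. by split=> // m U V ltU ltV; apply: revstack_sort_cat. Qed.

Lemma perm_max_node b m U V : perm_eq (max_node b m U V) (m :: U ++ V).
Proof.
case: b; rewrite /max_node perm_catC /= perm_cons //.
by rewrite perm_catC.
Qed.

Lemma max_node_inj b m U V U' V' :
    all (ltn^~ m) U -> all (ltn^~ m) V ->
    all (ltn^~ m) U' -> all (ltn^~ m) V' ->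
  max_node b m U V = max_node b m U' V' -> U = U' /\ V = V'.
Proof.
move=> ltU ltV ltU' ltV' E.
have := congr1 before_max E; have := congr1 after_max E.
by rewrite /max_node; case: b {E}; rewrite !before_max_cat ?after_max_cat.
Qed.

Lemma max_nodeP b w : uniq w -> w != [::] ->
  exists m U V, [/\ w = max_node b m U V, all (ltn^~ m) U & all (ltn^~ m) V].
Proof.
move=> uw w0; pose m := maxentry w.
have mw : m \in w by case: (w) (w0) @m => // x s _; apply: maxentry_in.
have wE : w = before_max w ++ m :: after_max w.
  by rewrite -{1}(cat_take_drop (index m w) w) (drop_nth 0) ?index_mem ?nth_index.
have lt_m x : x \in w -> x != m -> (x < m)%N.
  move=> xw; rewrite ltn_neqAle => -> /=.
  by rewrite /m /maxentry; apply: leq_bigmax_seq.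
have ltm s : {subset s <= w} -> m \notin s -> all (ltn^~ m) s.
  move=> sw ms; apply/allP=> x xs; apply: lt_m; first exact: sw.
  by apply: contraNneq ms => <-.
have : uniq (m :: before_max w ++ after_max w).
  by rewrite -(perm_uniq (perm_max_node true m _ _)) /= -wE.
rewrite /= mem_cat negb_or => /andP[/andP[mL mR] _].
have ltL := ltm _ (@mem_take _ _ w) mL; have ltR := ltm _ (@mem_drop _ _ w) mR.
by case: b; [exists m, (before_max w), (after_max w) |
             exists m, (after_max w), (before_max w)].
Qed.

Section SortableWords.

Variables (b : bool) (f : seq nat -> seq nat).
Hypothesis f_sorter : max_sorter b f.

Lemma perm_max_sorter w : uniq w -> perm_eq (f w) w.
Proof.
have [f0 fE] := f_sorter.
have [e] := ubnP (size w); elim: e w => // e IHe w le_e uw.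
have [->|w0] := eqVneq w [::]; first by rewrite f0.
have [m [U [V [wE ltU ltV]]]] := max_nodeP b uw w0.
have pw : perm_eq w (m :: U ++ V) by rewrite wE perm_max_node.
move: uw le_e; rewrite (perm_uniq pw) (perm_size pw) /= cat_uniq size_cat.
case/and4P=> _ uU _ uV; rewrite ltnS => le_e.
rewrite {1}wE fE // perm_sym (perm_trans pw) // catA perm_sym perm_catC perm_cons.
by apply: perm_cat; apply: IHe => //; apply: leq_trans le_e;
  rewrite ltnS ?leq_addl ?leq_addr.
Qed.

Definition sortable (a n : nat) : seq (seq nat) :=
  [seq w <- permutations (iota a n) | f w == iota a n].

Lemma mem_sortable a n w :
  (w \in sortable a n) = uniq w && (f w == iota a n).
Proof.
rewrite mem_filter mem_permutations andbC.
have [E|//] := f w =P _; last by rewrite !andbF.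
rewrite !andbT; apply/idP/idP=> [/perm_uniq->|uw]; first exact: iota_uniq.
by rewrite -E perm_sym perm_max_sorter.
Qed.

Lemma sortable_perm a n w : w \in sortable a n -> perm_eq w (iota a n).
Proof. by rewrite mem_filter mem_permutations => /andP[]. Qed.

Lemma sortable_lt a n m w :
  (a + n <= m)%N -> w \in sortable a n -> all (ltn^~ m) w.
Proof.
move=> le_m /sortable_perm/perm_mem E; apply/allP=> x; rewrite E mem_iota.
by case/andP=> _ /leq_trans; apply.
Qed.

Lemma sortable_size a n w : w \in sortable a n -> size w = n.
Proof. by move/sortable_perm/perm_size; rewrite size_iota. Qed.

Definition sortable_pairs (a n i : nat) :=
  [seq (U, V) | U <- sortable a i, V <- sortable (a + i) (n - i)].

Lemma sortable_pairsP a n i p : (i <= n)%N -> p \in sortable_pairs a n i ->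
  [/\ p.1 \in sortable a i, p.2 \in sortable (a + i) (n - i),
      all (ltn^~ (a + n)) p.1 & all (ltn^~ (a + n)) p.2].
Proof.
move=> le_in /allpairsP[[U V] /= [sU sV ->]]; split=> //=.
  by apply: sortable_lt sU; rewrite leq_add2l.
by apply: sortable_lt sV; rewrite -addnA subnKC.
Qed.

(** From f U ++ f V = iota a n and the fact that f permutes its argument, U is a
    sortable arrangement of the size U smallest entries and V one of the rest.
    The splitting is unique since m exceeds all other entries. *)
Lemma sortableS_perm a n :
  perm_eq (sortable a n.+1)
    [seq max_node b (a + n) p.1 p.2
       | i <- iota 0 n.+1, p <- sortable_pairs a n i].
Proof.
have [_ fE] := f_sorter.
apply: uniq_perm.
- by rewrite filter_uniq ?permutations_uniq.
- apply: allpairs_uniq_dep; first exact: iota_uniq.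
    move=> i _; apply: allpairs_uniq; try by rewrite filter_uniq ?permutations_uniq.
    by move=> [U V] [U' V'] _ _ [-> ->].
  move=> _ _ /allpairsPdep[i [p [i_n pi ->]]] /allpairsPdep[j [q [j_n qj ->]]] /=.
  move: i_n j_n; rewrite !mem_iota /= !add0n !ltnS => i_n j_n.
  case: (sortable_pairsP i_n pi) (sortable_pairsP j_n qj) => pU pV pltU pltV.
  case=> qU qV qltU qltV /max_node_inj[] // E1 E2.
  have Eij : i = j by rewrite -(sortable_size pU) -(sortable_size qU) E1.
  rewrite -{}Eij; congr (Tagged _ _).
  by rewrite (surjective_pairing p) (surjective_pairing q) E1 E2.
- move=> w; apply/idP/allpairsPdep => [|[i [p [i_n pi ->]]]]; last first.
    move: i_n; rewrite mem_iota /= add0n ltnS => i_n.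
    case: (sortable_pairsP i_n pi) => pU pV ltU ltV.
    have := sortable_perm pU; have := sortable_perm pV => permV permU.
    move: pU pV; rewrite !mem_sortable => /andP[uU /eqP EU] /andP[uV /eqP EV].
    rewrite fE // EU EV catA -iotaD subnKC // -[n.+1]addn1 iotaD eqxx andbT.
    rewrite (perm_uniq (perm_max_node _ _ _ _)).
    have permUV : perm_eq (p.1 ++ p.2) (iota a n).
      by rewrite -[X in iota a X](subnKC i_n) iotaD perm_cat.
    rewrite /= (perm_mem permUV) (perm_uniq permUV) iota_uniq.
    by rewrite mem_iota ltnn andbF.
rewrite mem_sortable => /andP[uw /eqP Ew].
have w0 : w != [::].
  by apply/eqP=> w0; move: Ew; rewrite w0 f_sorter.1.
have [m [U [V [wE ltU ltV]]]] := max_nodeP b uw w0.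
have := uw; rewrite wE (perm_uniq (perm_max_node _ _ _ _)) /= cat_uniq.
case/and4P=> _ uU _ uV; move: Ew; rewrite wE fE // -[n.+1]addn1 iotaD catA.
rewrite !cats1 => /rcons_inj[E Em].
have sU : size (f U) = size U by apply/perm_size/perm_max_sorter.
have sV : size (f V) = size V by apply/perm_size/perm_max_sorter.
have szn : n = (size U + size V)%N by rewrite -sU -sV -size_cat E size_iota.
have : f U ++ f V == iota a (size U) ++ iota (a + size U) (size V).
  by rewrite -iotaD -szn E.
rewrite eqseq_cat ?size_iota // => /andP[EU EV].
exists (size U), (U, V); split; last by rewrite -Em.
  by rewrite -[0%N :: _]/(iota 0 n.+1) mem_iota add0n ltnS szn leq_addr.
by apply: allpairs_f; rewrite mem_sortable ?uU ?uV // szn addKn.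
Qed.

(** Letting the alphabet start at an arbitrary a makes the induction apply to V
    directly, with no need to renumber its entries. *)
Lemma sum_weight_sortable a n :
  \sum_(w <- sortable a n) weight w = narayana n.
Proof.
have [e] := ubnP n; elim: e n a => // e IHe [|n] a lt_e.
  have -> : sortable a 0 = [:: [::]] by rewrite /sortable /= f_sorter.1.
  by rewrite big_seq1.
rewrite (perm_big _ (sortableS_perm a n)) big_allpairs_dep.
rewrite -[iota 0 n.+1]/(index_iota 0 n.+1) big_mkord (narayana_rec b).
apply: eq_bigr => i _; have le_in : (i <= n)%N by rewrite -ltnS.
have lt_ie : (i < e)%N by apply: leq_ltn_trans le_in _.
have lt_nie : (n - i < e)%N by apply: leq_ltn_trans (leq_subr _ _) _.
have -> : narayana i * narayana (n - i) =
    \sum_(p <- sortable_pairs a n i) weight p.1 * weight p.2.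
  by rewrite big_allpairs -(IHe i a) // -(IHe (n - i)%N (a + i)%N) ?big_distrlr.
rewrite mulr_sumr big_seq [RHS]big_seq; apply: eq_bigr => p.
case/(sortable_pairsP le_in) => sU sV ltU ltV.
rewrite -(sortable_size sV) -(sortable_size sU) /max_node.
by case: b; rewrite weight_max_cat // [weight p.2 * _]mulrC.
Qed.

End SortableWords.

(** * Enumeration *)

Lemma sum_des_sorter b f n : max_sorter b f -> (0 < n)%N ->
  \sum_(w <- permwords n | f w == idword n) 'X^(1 + des w)%N = narayana n.
Proof.
move=> f_sorter n_gt0; rewrite -(sum_weight_sortable f_sorter 1) big_filter.
rewrite big_seq_cond [RHS]big_seq_cond; apply: eq_bigr => w /andP[].
rewrite mem_permutations => /perm_size; rewrite size_iota => sz_w _.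
by case: w sz_w n_gt0 => // <-.
Qed.

Theorem theorem3p1 (n : nat) (hn : (1 <= n)%N) :
  \sum_(w <- permwords n | revstack_sort w == idword n) 'X^(1 + des w)%N
    = \sum_(0 <= k < n)
        (n%:R^-1 * 'C(n, k)%:R * 'C(n, k.+1)%:R) *: 'X^(n - k)%N :> {poly rat}
  /\
  \sum_(0 <= k < n)
      (n%:R^-1 * 'C(n, k)%:R * 'C(n, k.+1)%:R) *: 'X^(n - k)%N
    = \sum_(w <- permwords n | stack_sort w == idword n) 'X^(1 + des w)%N
      :> {poly rat}.
Proof.
rewrite -narayanaE // (sum_des_sorter revstack_sort_max_sorter) //.
by rewrite (sum_des_sorter stack_sort_max_sorter).
Qed.
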